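(* Suppose that $\Gamma_1$ and $\Gamma_3$ are invertible and that $$\Theta_2=\Gamma_2\Gamma_1^{-1}\Theta_1+\Theta_3\Xi_2^{-1}\Xi_1-\Gamma_3\Xi_2^{-1}\Xi_1\Gamma_1^{-1}\Theta_1 .$$ Take $$\widetilde\Phi=\Gamma_1,\qquad \widetilde\Psi=\Theta_1,\qquad \Phi=\operatorname{Id},\qquad \Psi=\Xi_2\Gamma_3^{-1}\Theta_3\Xi_2^{-1}.$$ Then the condition $$\begin{pmatrix} \Gamma_1 & 0 \\ \Gamma_2 & \Gamma_3\end{pmatrix}\overline X_{2n}+\begin{pmatrix}\Theta_1 & 0 \\ \Theta_2 & \Theta_3\end{pmatrix} X_{2n}=0$$ is equivalent to the condition $$\begin{pmatrix} \widetilde\Phi & 0 \\ \Phi\Xi_1 & \Phi\Xi_2\end{pmatrix}\overline X_{2n}+\begin{pmatrix}\widetilde\Psi & 0 \\ \Psi\Xi_1 & \Psi\Xi_2\end{pmatrix} X_{2n}=0,$$ and, therefore, the reduced problem $$Su=Rh \text{ on } I,\qquad B_ku=0,\quad B_kRu=0,\quad k=1,\dots,n,$$ and the factored problem $$L_1u=y \text{ on } I,\quad V_ju=0,\ j=1,\dots,n,\qquad\qquad L_2y=Rh \text{ on } I,\quad \widetilde V_jy=0,\ j=1,\dots,n,$$ are equivalent, in the sense that $u\in W^{2n,1}(I)$ solves the reduced problem if and only if $u$ together with $y=L_1u\in W^{n,1}(I)$ solves the factored problem.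
   Context: Let $T>0$, $I=[-T,T]$, $n\in\mathbb{N}$, $n\ge 1$. Let $D$ be the differentiation operator, $\operatorname{Id}$ the identity (operator or matrix), and $\varphi^*$ the reflection operator $(\varphi^*u)(t)=u(-t)$. Let $$L=\sum_{k=0}^n(a_k\varphi^*+b_k)D^k,\qquad R=\sum_{k=0}^n a_k\varphi^*D^k+\sum_{l=0}^n(-1)^{l+1}b_lD^l,$$ with $a_k,b_k\in\mathbb{R}$ and $a_n^2\neq b_n^2$. It is known that $S:=RL=LR$ is an ordinary differential operator with constant real coefficients (a real polynomial in $D$), of order $2n$. Assume $S=L_2L_1$, where $L_1=\sum_{l=0}^n c_lD^l$ with $c_l\in\mathbb{R}$, $c_n\neq 0$, and $L_2$ is a real polynomial in $D$ of order $n$. Let $h\in W^{n,1}(I)$. Boundary conditions: for $k=1,\dots,n$, $$B_ku=\sum_{j=0}^{n-1}\left[\alpha_{kj}u^{(j)}(-T)+\beta_{kj}u^{(j)}(T)\right],\qquad \alpha_{kj},\beta_{kj}\in\mathbb{R}.$$ For $m\in\{n,2n\}$ write, as column vectors, $X_m=(u(T),u'(T),\dots,u^{(m-1)}(T))$ and $\overline X_m=(u(-T),u'(-T),\dots,u^{(m-1)}(-T))$. Put $\Gamma_1=(\alpha_{kj})$ and $\Theta_1=(\beta_{kj})$ ($k=1,\dots,n$, $j=0,\dots,n-1$), so that the conditions $B_ku=0$, $k=1,\dots,n$, read $\Gamma_1\overline X_n+\Theta_1X_n=0$. Let $\Gamma_2,\Gamma_3,\Theta_2,\Theta_3$ be the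 real $n\times n$ matrices such that the vector $(B_kRu)_{k=1}^n$ equals $(\Gamma_2\ \Gamma_3)\overline X_{2n}+(\Theta_2\ \Theta_3)X_{2n}$. Let $\Xi=(\Xi_1\ \Xi_2)$ be the real $n\times 2n$ matrix with rows indexed by $j=0,\dots,n-1$ and columns by $k=0,\dots,2n-1$, with entry $c_{k-j}$ if $0\le k-j\le n$ and $0$ otherwise; $\Xi_1$ and $\Xi_2$ are its left and right $n\times n$ blocks ($\Xi_2$ is invertible because $c_n\neq0$). Given real $n\times n$ matrices $\widetilde\Phi,\widetilde\Psi,\Phi,\Psi$, the boundary operators $V_j$ and $\widetilde V_j$, $j=1,\dots,n$, are defined by: $V_ju$ is the $j$-th component of $\widetilde\Phi\,\overline X_n+\widetilde\Psi X_n$, and $\widetilde V_jy$ is the $j$-th component of $\Phi\,(y(-T),\dots,y^{(n-1)}(-T))^{\top}+\Psi\,(y(T),\dots,y^{(n-1)}(T))^{\top}$. *)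

(* Defs.v *)
From HB Require Import structures.
From mathcomp Require Import all_boot all_order all_algebra.
From mathcomp Require Import all_classical all_reals all_analysis.

Set Implicit Arguments.
Unset Strict Implicit.
Unset Printing Implicit Defensive.

Import Order.TTheory GRing.Theory Num.Theory.
Import numFieldNormedType.Exports.

Local Open Scope classical_set_scope.
Local Open Scope ring_scope.

(* Functions on I = [-T, T] are represented by total functions R -> R whose
   values outside I are irrelevant: every notion below depends only on the
   restriction to I. *)

(* Difference quotients are taken within I, so that derivatives at -T and T are
   one-sided. *)
Definition diffquot (R : realType) (u : R -> R) (t s : R) : R :=
  (u s - u t) / (s - t).

Definition derivable_in (R : realType) (T : R) (u : R -> R) (t : R) : Prop :=
  cvg (diffquot u t s @[s --> within `[- T, T]%classic t^']).

Definition D (R : realType) (T : R) (u : R -> R) : R -> R :=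
  fun t => lim (diffquot u t s @[s --> within `[- T, T]%classic t^']).

Definition Dn (R : realType) (T : R) (k : nat) (u : R -> R) : R -> R :=
  iter k (D T) u.

Definition abs_continuous (R : realType) (T : R) (f : R -> R) : Prop :=
  forall e : R, 0 < e -> exists2 d : R, 0 < d &
    forall (N : nat) (x y : 'I_N -> R),
      (forall i, [/\ - T <= x i, x i <= y i & y i <= T]) ->
      trivIset setT (fun i => `]x i, y i[%classic) ->
      \sum_(i < N) (y i - x i) < d ->
      \sum_(i < N) `|f (y i) - f (x i)| < e.

(* W^{m,1}(I) for m >= 1: u is of class C^{m-1} on I and u, ..., u^(m-1) are
   absolutely continuous on I.  Then u^(m) = Dn T m u exists almost everywhere
   on I and is integrable.  This is the absolutely continuous representative,
   the one for which the boundary values u^(j)(-T), u^(j)(T) make sense. *)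
Definition sobolev (R : realType) (T : R) (m : nat) (u : R -> R) : Prop :=
  (forall k t, (k.+1 < m)%N -> t \in `[- T, T] -> derivable_in T (Dn T k u) t) /\
  (forall k, (k < m)%N -> abs_continuous T (Dn T k u)).

(* Equality of L^1(I): derivatives of top order exist only almost everywhere. *)
Definition eq_on (R : realType) (T : R) (f g : R -> R) : Prop :=
  {ae (@lebesgue_measure R), forall t, t \in `[- T, T] -> f t = g t}.

Definition reflection (R : realType) (u : R -> R) : R -> R := fun t => u (- t).

Definition opL (R : realType) (T : R) (n : nat) (a b : nat -> R)
    (u : R -> R) : R -> R :=
  fun t => \sum_(k < n.+1) (a k * reflection (Dn T k u) t + b k * Dn T k u t).

Definition opR (R : realType) (T : R) (n : nat) (a b : nat -> R)
    (u : R -> R) : R -> R :=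
  fun t => \sum_(k < n.+1) a k * reflection (Dn T k u) t
           + \sum_(l < n.+1) (-1) ^+ l.+1 * b l * Dn T l u t.

Definition opS (R : realType) (T : R) (n : nat) (a b : nat -> R)
    (u : R -> R) : R -> R :=
  opR T n a b (opL T n a b u).

Definition polyD (R : realType) (T : R) (n : nat) (c : nat -> R)
    (u : R -> R) : R -> R :=
  fun t => \sum_(l < n.+1) c l * Dn T l u t.

(* X_m = jet T m u T and \overline X_m = jet T m u (- T). *)
Definition jet (R : realType) (T : R) (m : nat) (u : R -> R) (t : R) : 'cV[R]_m :=
  \col_(j < m) Dn T j u t.

Definition opB (R : realType) (T : R) (n : nat) (alpha beta : 'M[R]_n)
    (k : 'I_n) (u : R -> R) : R :=
  \sum_(j < n) (alpha k j * Dn T j u (- T) + beta k j * Dn T j u T).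

Definition opV (R : realType) (T : R) (n : nat) (Phi Psi : 'M[R]_n)
    (j : 'I_n) (u : R -> R) : R :=
  (Phi *m jet T n u (- T) + Psi *m jet T n u T) j 0.

Definition Xi (R : realType) (n : nat) (c : nat -> R) : 'M[R]_(n, n + n) :=
  \matrix_(j < n, k < n + n)
    if (j <= k)%N && (k - j <= n)%N then c (k - j)%N else 0.

Definition Xi1 (R : realType) (n : nat) (c : nat -> R) : 'M[R]_n :=
  lsubmx (Xi n c).

Definition Xi2 (R : realType) (n : nat) (c : nat -> R) : 'M[R]_n :=
  rsubmx (Xi n c).

Definition reduced_problem (R : realType) (T : R) (n : nat) (a b : nat -> R)
    (h : R -> R) (Gamma1 Theta1 : 'M[R]_n) (u : R -> R) : Prop :=
  [/\ eq_on T (opS T n a b u) (opR T n a b h),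
      forall k, opB T Gamma1 Theta1 k u = 0
    & forall k, opB T Gamma1 Theta1 k (opR T n a b u) = 0].

(* L_1 = polyD T n c and L_2 = polyD T n d; the boundary operators V_j have
   matrices PhiV, PsiV and the \widetilde V_j have matrices Phi, Psi. *)
Definition factored_problem (R : realType) (T : R) (n : nat) (a b c d : nat -> R)
    (h : R -> R) (PhiV PsiV Phi Psi : 'M[R]_n) (u y : R -> R) : Prop :=
  [/\ eq_on T (polyD T n c u) y,
      forall j, opV T PhiV PsiV j u = 0,
      eq_on T (polyD T n d y) (opR T n a b h)
    & forall j, opV T Phi Psi j y = 0].

(* Main.v *)
Require Import Defs.
From HB Require Import structures.
From mathcomp Require Import all_boot all_order all_algebra.
From mathcomp Require Import all_classical all_reals all_analysis.
From mathcomp Require Import zify lra.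

Set Implicit Arguments.
Unset Strict Implicit.
Unset Printing Implicit Defensive.

Import Order.TTheory GRing.Theory Num.Theory.
Import numFieldNormedType.Exports.

Local Open Scope ring_scope.

(** The two boundary value problems share the conditions B_k u = 0, and their
    differential equations agree almost everywhere because S = L_2 L_1; so
    everything rests on comparing the remaining boundary conditions, B_k R u = 0
    on one side and those on y = L_1 u on the other.

    Both are linear in the jets of u of order 2n at -T and T.  For the first this
    is the definition of Gamma_2, Gamma_3, Theta_2, Theta_3.  For the second,
    differentiating y = sum_l c_l u^(l) shows that the jet of y of order n is Xi
    times the jet of u of order 2n ([jet_polyD]).  This needs u to be in W^{2n,1}
    and derivatives on I to be linear and to depend only on values in I;
    absolute continuity of linear combinations then gives y in W^{n,1}
    ([sobolev_polyD]).

    What is left is linear algebra ([boundary_row_reduction]).  Split the jets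
    into upper and lower halves p, q at -T and p', q' at T.  Multiplying the
    condition on y by the invertible matrix Gamma_3 Xi_2^{-1} makes the
    coefficients of q and q' equal to Gamma_3 and Theta_3, as in B_k R u = 0.
    Given p = - Gamma_1^{-1} Theta_1 p', which is the shared condition, the
    remaining coefficients of p' agree exactly when Theta_2 has the prescribed
    value. *)

(** * Derivatives within the interval *)

(** Needed for limits of difference quotients to be unique: since T > 0, the
    interval has no isolated point, not even an end point. *)
Lemma interval_punctured_nbhs_proper (R : realType) (T t : R) :
  0 < T -> t \in `[- T, T] -> ProperFilter (within `[- T, T]%classic t^'%classic).
Proof.
move=> T0; rewrite in_itv/= => /andP[Tt tT].
apply: Build_ProperFilter => /nbhs_ballP[e /= e0 He].
have [ltT|] := ltP t T.
  apply: (He (Num.min (t + e / 2) T)).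
  - rewrite /ball/= ltr_norml; case: (leP (t + e / 2) T); lra.
  - by rewrite gt_eqF// lt_min ltT andbT; lra.
  - by rewrite /= in_itv/=; case: (leP (t + e / 2) T); lra.
move=> geT.
apply: (He (Num.max (t - e / 2) (- T))).
- rewrite /ball/= ltr_norml; case: (leP (t - e / 2) (- T)); lra.
- by rewrite lt_eqF// gt_max; lra.
- by rewrite /= in_itv/=; case: (leP (t - e / 2) (- T)); lra.
Qed.

Lemma near_diffquot_eq (R : realType) (T : R) (u v : R -> R) (t : R) :
  t \in `[- T, T] -> {in `[- T, T], u =1 v} ->
  {near within `[- T, T]%classic t^'%classic, diffquot u t =1 diffquot v t}.
Proof.
move=> tI uv; apply: filterS (withinT _ _) => s /= sI.
by rewrite /diffquot !uv.
Qed.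

Lemma derivable_in_eq (R : realType) (T : R) (u v : R -> R) (t : R) :
  0 < T -> t \in `[- T, T] -> {in `[- T, T], u =1 v} ->
  derivable_in T u t -> derivable_in T v t /\ D T v t = D T u t.
Proof.
move=> T0 tI uv du.
have pF := interval_punctured_nbhs_proper T0 tI.
have dv : (diffquot v t s @[s --> within `[- T, T]%classic t^'%classic]
            --> D T u t)%classic.
  apply: cvg_trans du; apply: near_eq_cvg; exact: near_diffquot_eq.
split; first by apply/cvg_ex; exists (D T u t).
exact: (cvg_lim (@Rhausdorff R) dv).
Qed.

Lemma cvg_bigsum (R : realType) (X I : Type) (F : set_system X) (r : seq I)
    (f : I -> X -> R) (l : I -> R) :
  Filter F -> (forall i, f i x @[x --> F] --> l i)%classic ->
  (\sum_(i <- r) f i x @[x --> F] --> \sum_(i <- r) l i)%classic.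
Proof.
move=> FF fl; elim: r => [|i r IHr].
  rewrite big_nil (_ : (fun x => _) = cst 0); first exact: cvg_cst.
  by apply/funext => x; rewrite big_nil.
rewrite big_cons (_ : (fun x => _) = f i \+ (fun x => \sum_(j <- r) f j x)).
  exact: cvgD.
by apply/funext => x; rewrite big_cons.
Qed.

Lemma D_sum (R : realType) (T : R) (I : Type) (r : seq I) (c : I -> R)
    (f : I -> R -> R) (t : R) :
  0 < T -> t \in `[- T, T] -> (forall i, derivable_in T (f i) t) ->
  derivable_in T (fun s => \sum_(i <- r) c i * f i s) t /\
  D T (fun s => \sum_(i <- r) c i * f i s) t = \sum_(i <- r) c i * D T (f i) t.
Proof.
move=> T0 tI df.
have pF := interval_punctured_nbhs_proper T0 tI.
have diffquotE s : diffquot (fun x => \sum_(i <- r) c i * f i x) t s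
    = \sum_(i <- r) c i * diffquot (f i) t s.
  rewrite /diffquot -sumrB mulr_suml; apply: eq_bigr => i _.
  by rewrite -mulrBr mulrA.
have cf : (diffquot (fun x => \sum_(i <- r) c i * f i x) t s
    @[s --> within `[- T, T]%classic t^'%classic]
    --> \sum_(i <- r) c i * D T (f i) t)%classic.
  rewrite (funext diffquotE).
  by apply: cvg_bigsum => i; apply: cvgMl_tmp; exact: df.
split; first by apply/cvg_ex; eexists; exact: cf.
exact: (cvg_lim (@Rhausdorff R) cf).
Qed.

(** * Absolute continuity of linear combinations *)

Lemma abs_continuous_eq (R : realType) (T : R) (f g : R -> R) :
  {in `[- T, T], f =1 g} -> abs_continuous T f -> abs_continuous T g.
Proof.
move=> fg ACf e e0; have [d d0 fd] := ACf e e0; exists d => // N x y xy dis sd.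
rewrite (eq_bigr (fun i => `|f (y i) - f (x i)|)); first exact: fd.
by move=> i _; have [? ? ?] := xy i; rewrite !fg// in_itv/=; lra.
Qed.

Lemma abs_continuousZD (R : realType) (T k : R) (f g : R -> R) :
  abs_continuous T f -> abs_continuous T g ->
  abs_continuous T (fun t => k * f t + g t).
Proof.
move=> ACf ACg e e0.
have k0 : 0 < `|k| + 1 by rewrite ltr_wpDl.
have e20 : 0 < e / 2 by lra.
have [d1 d10 fd] := ACf (e / 2 / (`|k| + 1)) (divr_gt0 e20 k0).
have [d2 d20 gd] := ACg _ e20.
exists (Num.min d1 d2) => [|N x y xy dis]; first by rewrite lt_min d10.
rewrite lt_min => /andP[/(fd _ _ _ xy dis) sf /(gd _ _ _ xy dis) sg].
apply: (@le_lt_trans _ _ (\sum_(i < N)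
    (`|k| * `|f (y i) - f (x i)| + `|g (y i) - g (x i)|))).
  apply: ler_sum => i _; rewrite -normrM mulrBr.
  apply: le_trans (ler_normD _ _).
  by rewrite opprD addrACA.
rewrite big_split/= -mulr_sumr [ltRHS](splitr e); apply: ler_ltD sg.
move: sf; rewrite ltr_pdivlMr// mulrC => /ltW; apply: le_trans.
by rewrite ler_wpM2r ?sumr_ge0// lerDl.
Qed.

Lemma abs_continuous_sum (R : realType) (T : R) (I : Type) (r : seq I)
    (c : I -> R) (f : I -> R -> R) :
  (forall i, abs_continuous T (f i)) ->
  abs_continuous T (fun t => \sum_(i <- r) c i * f i t).
Proof.
move=> ACf; elim: r => [|i r IHr].
  move=> e e0; exists 1 => // N x y _ _ _.
  by rewrite big1// => i _; rewrite !big_nil subrr normr0.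
apply: (@abs_continuous_eq _ _ (fun t => c i * f i t + \sum_(j <- r) c j * f j t)).
  by move=> t _; rewrite big_cons.
exact: abs_continuousZD.
Qed.

(** * Equality almost everywhere on the interval *)

Lemma eq_on_sym (R : realType) (T : R) (f g : R -> R) :
  eq_on T f g -> eq_on T g f.
Proof.
have FF := @ae_filter_ringOfSetsType _ _ _ (@lebesgue_measure R).
by apply: filterS => t fg /fg.
Qed.

Lemma eq_on_eq_l (R : realType) (T : R) (f g k : R -> R) :
  eq_on T f g -> eq_on T f k -> eq_on T g k.
Proof.
have FF := @ae_filter_ringOfSetsType _ _ _ (@lebesgue_measure R).
by apply: filterS2 => t fg fk tI; rewrite -fg// fk.
Qed.

(** * Constant coefficient operators on Sobolev functions *)

(** Each differentiation of the sum is legitimate because the highest derivative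
    of u that it meets has order at most n + m - 1, and those of lower order are
    differentiable at every point of the interval.  The induction hypothesis is
    an identity on the interval only, so it is transported through the derivative
    by locality. *)
Lemma Dn_polyD (R : realType) (T : R) (m n : nat) (c : nat -> R) (u : R -> R)
    (k : nat) :
  0 < T -> sobolev T (n + m) u -> (k < m)%N ->
  {in `[- T, T],
    Dn T k (polyD T n c u) =1 fun t => \sum_(l < n.+1) c l * Dn T (k + l) u t}.
Proof.
move=> T0 [du _]; elim: k => [//|k IHk] km t tI.
have sub : {in `[- T, T], (fun t => \sum_(l < n.+1) c l * Dn T (k + l) u t) =1
    Dn T k (polyD T n c u)} by move=> s sI; rewrite IHk//; exact: ltnW.
have dkl (l : 'I_n.+1) : derivable_in T (Dn T (k + l) u) t.
  by apply: du => //; have := ltn_ord l; lia.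
have [dsum Dsum] := @D_sum _ T _ (index_enum 'I_n.+1) (fun l => c l) _ t T0 tI dkl.
have [_ DE] := derivable_in_eq T0 tI sub dsum.
exact: etrans DE Dsum.
Qed.

Lemma sobolev_polyD (R : realType) (T : R) (m n : nat) (c : nat -> R)
    (u : R -> R) :
  0 < T -> sobolev T (n + m) u -> sobolev T m (polyD T n c u).
Proof.
move=> T0 su; have [du ACu] := su; split=> [k t km tI|k km].
  have sub : {in `[- T, T], (fun t => \sum_(l < n.+1) c l * Dn T (k + l) u t) =1
      Dn T k (polyD T n c u)} by move=> s sI; rewrite (Dn_polyD c T0 su)//; exact: ltnW.
  have dkl (l : 'I_n.+1) : derivable_in T (Dn T (k + l) u) t.
    by apply: du => //; have := ltn_ord l; lia.
  have [dsum _] := @D_sum _ T _ (index_enum 'I_n.+1) (fun l => c l) _ t T0 tI dkl.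
  by have [] := derivable_in_eq T0 tI sub dsum.
apply: (@abs_continuous_eq _ _ (fun t => \sum_(l < n.+1) c l * Dn T (k + l) u t)).
  by move=> s sI; rewrite (Dn_polyD c T0 su).
apply: abs_continuous_sum => l; apply: ACu.
by have := ltn_ord l; lia.
Qed.

(** Row j of Xi carries c_0, ..., c_n shifted to columns j, ..., j + n, which
    are the orders of the derivatives of u occurring in the j-th derivative of
    the sum of the c_l u^(l). *)
Lemma jet_polyD (R : realType) (T : R) (n : nat) (c : nat -> R) (u : R -> R)
    (t : R) :
  0 < T -> sobolev T (n + n) u -> t \in `[- T, T] ->
  jet T n (polyD T n c u) t = Xi n c *m jet T (n + n) u t.
Proof.
move=> T0 su tI; apply/matrixP => j i; rewrite !mxE (Dn_polyD c T0 su)//.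
under [RHS]eq_bigr do rewrite !mxE.
rewrite -(big_mkord xpredT (fun l => c l * Dn T (j + l) u t)).
rewrite -(big_mkord xpredT (fun k => (if (j <= k)%N && (k - j <= n)%N
  then c (k - j)%N else 0) * Dn T k u t)).
have jn := ltn_ord j.
(* Only the columns from j to j + n contribute. *)
apply: esym; rewrite (big_cat_nat _ (n := j))//=; last by lia.
rewrite [X in X + _]big_nat_cond [X in X + _]big1 ?add0r; last first.
  by move=> k /andP[/andP[_ kj] _]; rewrite leqNgt kj mul0r.
rewrite (big_cat_nat _ (n := j + n.+1))//=; [|lia|lia].
rewrite [X in _ + X]big_nat_cond [X in _ + X]big1 ?addr0; last first.
  move=> k /andP[/andP[kj _] _]; case: ifP => [|_]; last by rewrite mul0r.
  by lia.
rewrite (_ : bigop.body _ _ _ = \sum_(0 + j <= k < j + n.+1)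
  (if (j <= k)%N && (k - j <= n)%N then c (k - j)%N else 0) * Dn T k u t) //.
rewrite big_addn addKn.
rewrite big_nat_cond [RHS]big_nat_cond; apply: eq_bigr => l /andP[/andP[_ ln] _].
by rewrite leq_addl addnK -ltnS ln addnC.
Qed.

(** * Boundary conditions *)

(** The entry (j, k) of Xi_2 is c_(n + k - j), which vanishes for k > j: the
    matrix is lower triangular with c_n all along the diagonal. *)
Lemma Xi2_unitmx (R : realType) (n : nat) (c : nat -> R) :
  c n != 0 -> Xi2 n c \in unitmx.
Proof.
move=> cn0; rewrite unitmxE det_trig.
  rewrite unitfE; apply/prodf_neq0 => i _; rewrite !mxE/=.
  have := ltn_ord i; rewrite addnK leqnn andbT => ?.
  by rewrite ifT//; lia.
apply/is_trig_mxP => i j ij; rewrite !mxE/= ifF//.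
by apply/negP => /andP[_]; lia.
Qed.

Lemma block_lower_trig_system_eq0 (R : realType) (n : nat)
    (G1 G2 G3 H1 H2 H3 : 'M[R]_n) (x y : 'cV[R]_(n + n)) :
  block_mx G1 0 G2 G3 *m x + block_mx H1 0 H2 H3 *m y = 0 <->
  G1 *m usubmx x + H1 *m usubmx y = 0 /\
  row_mx G2 G3 *m x + row_mx H2 H3 *m y = 0.
Proof.
rewrite -{1 3}(vsubmxK x) -{1 3}(vsubmxK y) !mul_block_col !mul_row_col !mul0mx !addr0.
rewrite add_col_mx -[0 in X in X <-> _]vsubmxK !linear0.
by split=> [/eq_col_mx[]|[-> ->]].
Qed.

(** Eliminating p through the first condition leaves p', q and q'.  The
    coefficients of q and q' match because of the shape of X2 G3^-1 H3 X2^-1,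
    those of p' because of the choice of H2.  Since G3 X2^-1 is invertible, the
    second conditions of the two systems become equivalent. *)
Lemma boundary_row_reduction (R : realType) (n : nat)
    (G1 G2 G3 H1 H2 H3 X1 X2 : 'M[R]_n) (p q p' q' : 'cV[R]_n) :
  G1 \in unitmx -> G3 \in unitmx -> X2 \in unitmx ->
  H2 = G2 *m invmx G1 *m H1 + H3 *m invmx X2 *m X1
       - G3 *m invmx X2 *m X1 *m invmx G1 *m H1 ->
  G1 *m p + H1 *m p' = 0 ->
  G2 *m p + G3 *m q + (H2 *m p' + H3 *m q') =
  G3 *m invmx X2 *m (X1 *m p + X2 *m q
    + X2 *m invmx G3 *m H3 *m invmx X2 *m (X1 *m p' + X2 *m q')).
Proof.
move=> uG1 uG3 uX2 -> e1.
have -> : p = - (invmx G1 *m H1 *m p').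
  by rewrite -mulmxA -(addr0_eq e1) mulmxN mulKmx// opprK.
rewrite !mulmxDr !mulmxDl !mulmxN !mulNmx !mulmxA.
rewrite !(mulmxKV uX2) (mulmxV uG3) mul1mx.
set A := G2 *m _ *m _ *m _; set B := H3 *m _ *m _ *m _.
set C := G3 *m _ *m _ *m _ *m _ *m _.
by rewrite addrACA [RHS]addrACA -(addrA A) addKr (addrC B).
Qed.

(** * Equivalence of the reduced and the factored problem *)

Theorem lemma4p1 (R : realType) (T : R) (hT : 0 < T) (n : nat) (hn : (1 <= n)%N)
    (a b : nat -> R) (hab : a n ^+ 2 != b n ^+ 2)
    (c d : nat -> R) (hc : c n != 0) (hd : d n != 0)
    (hS : forall u : R -> R, sobolev T (n + n) u ->
       eq_on T (opS T n a b u) (polyD T n d (polyD T n c u)))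
    (h : R -> R) (hh : sobolev T n h)
    (Gamma1 Theta1 Gamma2 Gamma3 Theta2 Theta3 : 'M[R]_n)
    (hBR : forall u : R -> R, sobolev T (n + n) u ->
       \col_(k < n) opB T Gamma1 Theta1 k (opR T n a b u)
       = row_mx Gamma2 Gamma3 *m jet T (n + n) u (- T)
         + row_mx Theta2 Theta3 *m jet T (n + n) u T)
    (hG1 : Gamma1 \in unitmx) (hG3 : Gamma3 \in unitmx)
    (hTheta2 : Theta2 =
       Gamma2 *m invmx Gamma1 *m Theta1
       + Theta3 *m invmx (Xi2 n c) *m Xi1 n c
       - Gamma3 *m invmx (Xi2 n c) *m Xi1 n c *m invmx Gamma1 *m Theta1)
    (PhiV PsiV Phi Psi : 'M[R]_n)
    (hPhiV : PhiV = Gamma1) (hPsiV : PsiV = Theta1) (hPhi : Phi = 1%:M)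
    (hPsi : Psi = Xi2 n c *m invmx Gamma3 *m Theta3 *m invmx (Xi2 n c))
    (u : R -> R) (hu : sobolev T (n + n) u) :
  (block_mx Gamma1 0 Gamma2 Gamma3 *m jet T (n + n) u (- T)
     + block_mx Theta1 0 Theta2 Theta3 *m jet T (n + n) u T = 0
   <->
   block_mx PhiV 0 (Phi *m Xi1 n c) (Phi *m Xi2 n c) *m jet T (n + n) u (- T)
     + block_mx PsiV 0 (Psi *m Xi1 n c) (Psi *m Xi2 n c) *m jet T (n + n) u T = 0)
  /\
  (reduced_problem T a b h Gamma1 Theta1 u
   <->
   sobolev T n (polyD T n c u) /\
   factored_problem T a b c d h PhiV PsiV Phi Psi u (polyD T n c u)).
Proof.
have uX2 := Xi2_unitmx hc.
have TI : T \in `[- T, T] by rewrite in_itv/=; lra.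
have NTI : - T \in `[- T, T] by rewrite in_itv/=; lra.
have usubmx_jet t : usubmx (jet T (n + n) u t) = jet T n u t.
  by apply/matrixP => i j; rewrite !mxE.
have bc_equiv : block_mx Gamma1 0 Gamma2 Gamma3 *m jet T (n + n) u (- T)
     + block_mx Theta1 0 Theta2 Theta3 *m jet T (n + n) u T = 0
   <->
   block_mx PhiV 0 (Phi *m Xi1 n c) (Phi *m Xi2 n c) *m jet T (n + n) u (- T)
     + block_mx PsiV 0 (Psi *m Xi1 n c) (Psi *m Xi2 n c) *m jet T (n + n) u T = 0.
  rewrite hPhiV hPsiV hPhi !mul1mx !block_lower_trig_system_eq0.
  move: (jet _ _ _ _) (jet _ _ _ _) => x y.
  rewrite -(vsubmxK x) -(vsubmxK y) !mul_row_col !col_mxKu -!(mulmxA Psi) -mulmxDr hPsi.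
  split=> -[e1]; rewrite (boundary_row_reduction _ _ hG1 hG3 uX2 hTheta2 e1)//; last first.
    by move=> ->; rewrite mulmx0.
  move=> e2; split=> //.
  have uX : Gamma3 *m invmx (Xi2 n c) \in unitmx by rewrite unitmx_mul hG3 unitmx_inv.
  by rewrite -[LHS](mulKmx uX) e2 mulmx0.
split=> //.
have red_bc : (forall k, opB T Gamma1 Theta1 k u = 0) /\
      (forall k, opB T Gamma1 Theta1 k (opR T n a b u) = 0) <->
   block_mx Gamma1 0 Gamma2 Gamma3 *m jet T (n + n) u (- T)
     + block_mx Theta1 0 Theta2 Theta3 *m jet T (n + n) u T = 0.
  rewrite block_lower_trig_system_eq0 -hBR// !usubmx_jet.
  have -> : Gamma1 *m jet T n u (- T) + Theta1 *m jet T n u T =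
      \col_k opB T Gamma1 Theta1 k u.
    apply/matrixP => i j; rewrite !mxE -big_split/=; apply: eq_bigr => l _.
    by rewrite !mxE.
  split=> -[e1 e2]; split.
  - by apply/matrixP => i j; rewrite !mxE.
  - by apply/matrixP => i j; rewrite !mxE.
  - by move=> k; have /matrixP/(_ k 0) := e1; rewrite !mxE.
  - by move=> k; have /matrixP/(_ k 0) := e2; rewrite !mxE.
have fac_bc : (forall j, opV T PhiV PsiV j u = 0) /\
      (forall j, opV T Phi Psi j (polyD T n c u) = 0) <->
   block_mx PhiV 0 (Phi *m Xi1 n c) (Phi *m Xi2 n c) *m jet T (n + n) u (- T)
     + block_mx PsiV 0 (Psi *m Xi1 n c) (Psi *m Xi2 n c) *m jet T (n + n) u T = 0.
  rewrite block_lower_trig_system_eq0 !usubmx_jet -!mul_mx_row /Xi1 /Xi2 !hsubmxK.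
  rewrite -!mulmxA -!jet_polyD//.
  split=> -[e1 e2]; split.
  - by apply/matrixP => i j; rewrite ord1 [RHS]mxE; exact: e1.
  - by apply/matrixP => i j; rewrite ord1 [RHS]mxE; exact: e2.
  - by move=> k; rewrite /opV e1 mxE.
  - by move=> k; rewrite /opV e2 mxE.
have eqS : eq_on T (opS T n a b u) (opR T n a b h) <->
    eq_on T (polyD T n d (polyD T n c u)) (opR T n a b h).
  by split; apply: eq_on_eq_l; [|apply: eq_on_sym]; exact: hS.
split=> [[/eqS eS B1 B2]|[_ [_ V1 /eqS eS V2]]].
  have [V1 V2] := (fac_bc.2 (bc_equiv.1 (red_bc.1 (conj B1 B2)))).
  split; first exact: sobolev_polyD.
  by split=> //; apply: nearW.
have [B1 B2] := (red_bc.2 (bc_equiv.2 (fac_bc.1 (conj V1 V2)))).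
by split.
Qed.
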